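(* Let $G$ be a Lie group and let $\pi:P\to M$ and $\widetilde{\pi}:\widetilde{P}\to M$ be principal $G$-bundles over the same manifold $M$. Then there is a one-to-one correspondence between the set $\mathcal{G}_{P,\widetilde{P}}$ of bundle morphisms from $P$ to $\widetilde{P}$ and the set $C^{\infty}(P\odot\widetilde{P},G)^{G\times G}$ of smooth $G\times G$-equivariant maps from the fibred product $P\odot\widetilde{P}$ to $G$.
   Context: $M$ is a connected paracompact real manifold; principal bundles are smooth, with free right $G$-action written $(p,g)\mapsto pg$. $\mathcal{G}_{P,\widetilde{P}}$ is the set of smooth maps $\sigma:P\to\widetilde{P}$ with $\widetilde{\pi}\circ\sigma=\pi$ and $\sigma(pg)=\sigma(p)g$ for all $p\in P$, $g\in G$. The fibred product is $P\odot\widetilde{P}:=\{(p,\widetilde{p})\in P\times\widetilde{P}:\pi(p)=\widetilde{\pi}(\widetilde{p})\}$, with right $G\times G$-action $(p,\widetilde{p})(g,h)=(pg,\widetilde{p}h)$. $C^{\infty}(P\odot\widetilde{P},G)^{G\times G}$ is the set of smooth maps $K:P\odot\widetilde{P}\to G$ such that $K(pg,\widetilde{p}h)=h^{-1}K(p,\widetilde{p})g$ for all $(p,\widetilde{p})\in P\odot\widetilde{P}$ and $(g,h)\in G\times G$. *)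

(* Defs.v *)
From HB Require Import structures.
From mathcomp Require Import all_boot all_order all_algebra.
From mathcomp Require Import all_classical all_reals all_analysis.

Set Implicit Arguments.
Unset Strict Implicit.
Unset Printing Implicit Defensive.

Import numFieldNormedType.Exports.
Local Open Scope classical_set_scope.
Local Open Scope ring_scope.

Section Smooth_functions.
Context {R : realType} {V W : normedModType R}.

(* D is meant to be open and V finite-dimensional, so that f is C^(k+1) on D  *)
(* iff it is (Frechet) differentiable on D with C^k directional derivatives.  *)
Fixpoint Ck_on (k : nat) (D : set V) (f : V -> W) : Prop :=
  if k is k'.+1 then
    (forall x, D x -> differentiable f x) /\ (forall v, Ck_on k' D ('D_v f))
  else forall x, D x -> {for x, continuous f}.

Definition Cinfty_on (D : set V) (f : V -> W) : Prop :=
  forall k, Ck_on k D f.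

End Smooth_functions.

Definition paracompact (T : topologicalType) : Prop :=
  forall A : set (set T), A `<=` open -> \bigcup_(U in A) U = setT ->
  exists B : set (set T),
    [/\ B `<=` open, \bigcup_(V in B) V = setT,
        forall V, B V -> exists2 U, A U & V `<=` U
      & forall x : T, exists2 N, nbhs x N &
          finite_set (B `&` [set V | V `&` N !=set0])].

(* A chart is only relevant on its domain; chart_fun takes arbitrary values   *)
(* elsewhere.                                                                 *)
Record chart (X : Type) (E : Type) :=
  Chart { chart_dom : set X; chart_fun :> X -> E }.

(* The inverse of c on its image; x0 is a default value outside of the image. *)
Definition chart_inv (X E : Type) (c : chart X E) (x0 : X) : E -> X :=
  'pinv_(fun=> x0) (chart_dom c) c.

(* c is a homeomorphism from an open subset of X onto an open subset of E.    *)
Definition is_chart {R : realType} {E : normedModType R} {X : topologicalType}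
    (c : chart X E) : Prop :=
  [/\ open (chart_dom c),
      {in chart_dom c &, injective c},
      forall x, chart_dom c x -> {for x, continuous c}
    & forall U : set X, open U -> U `<=` chart_dom c -> open (c @` U)].

(* A topological space with a distinguished set of charts, without any axiom: *)
(* this suffices to say what a smooth map is, also on products and fibred     *)
(* products.                                                                  *)
HB.mixin Record hasAtlas (R : realType) (E : normedModType R) X
    of Topological X := { atlas : set (chart X E) }.

#[short(type="chartedType")]
HB.structure Definition Charted (R : realType) (E : normedModType R) :=
  { X of hasAtlas R E X & Topological X }.

Arguments atlas {R E s}.

Definition compatible_charts {R : realType} {E : normedModType R}
    {X : topologicalType} (c d : chart X E) : Prop :=
  forall x0, (chart_dom c `&` chart_dom d) x0 ->
  Cinfty_on (c @` (chart_dom c `&` chart_dom d)) (d \o chart_inv c x0).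

HB.mixin Record Charted_isManifold (R : realType) (E : normedModType R) X
    of Charted R E X := {
  manifold_hausdorff : hausdorff_space X;
  manifold_paracompact : paracompact X;
  atlas_chart : forall c : chart X E, atlas c -> is_chart c;
  atlas_cover : forall x : X, exists2 c : chart X E, atlas c & chart_dom c x;
  atlas_compatible : forall c d : chart X E,
    atlas c -> atlas d -> compatible_charts c d
}.

#[short(type="manifoldType")]
HB.structure Definition Manifold (R : realType) (E : normedModType R) :=
  { X of Charted_isManifold R E X & Charted R E X }.

(* Smoothness on an open set D of a map which may be arbitrary outside of D.  *)
Definition smooth_on {R : realType} {E F : normedModType R}
    {X : chartedType E} {Y : chartedType F} (D : set X) (f : X -> Y) : Prop :=
  (forall x, D x -> {for x, continuous f}) /\
  (forall (c : chart X E) (d : chart Y F), atlas c -> atlas d ->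
     let D' := D `&` chart_dom c `&` f @^-1` chart_dom d in
     forall x0, D' x0 -> Cinfty_on (c @` D') (d \o f \o chart_inv c x0)).

Definition smooth {R : realType} {E F : normedModType R}
    {X : chartedType E} {Y : chartedType F} (f : X -> Y) : Prop :=
  smooth_on setT f.

Definition prod_chart (X E Y F : Type) (c : chart X E) (d : chart Y F) :
    chart (X * Y) (E * F) :=
  Chart (chart_dom c `*` chart_dom d) (fun z => (c z.1, d z.2)).

HB.instance Definition _ (R : realType) (E F : normedModType R)
    (X : chartedType E) (Y : chartedType F) :=
  hasAtlas.Build R (E * F)%type (X * Y)%type
    [set prod_chart cd.1 cd.2 |
       cd in (atlas : set (chart X E)) `*` (atlas : set (chart Y F))].

HB.mixin Record Manifold_isLieGroup (R : realType) (E : normedModType R) G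
    of Manifold R E G & Group G := {
  mulg_smooth : smooth (fun z : G * G => (z.1 * z.2)%g);
  invg_smooth : smooth (fun x : G => x^-1%g)
}.

#[short(type="lieGroupType")]
HB.structure Definition LieGroup (R : realType) (E : normedModType R) :=
  { G of Manifold_isLieGroup R E G & Manifold R E G & Group G }.

(* (pi, phi) is a G-equivariant diffeomorphism from pi^-1(U) onto U x G.      *)
Definition local_trivialization {R : realType} {E F H : normedModType R}
    {M : chartedType E} {G : lieGroupType F} {P : chartedType H}
    (pi : P -> M) (act : P -> G -> P) (U : set M) (phi : P -> G) : Prop :=
  let Phi p := (pi p, phi p) in
  [/\ open U,
      smooth_on (pi @^-1` U) Phi,
      forall p g, U (pi p) -> phi (act p g) = (phi p * g)%g
    & exists Psi : M * G -> P,
        [/\ smooth_on (U `*` setT) Psi,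
            forall p, U (pi p) -> Psi (Phi p) = p
          & forall z, U z.1 -> Phi (Psi z) = z]].

Record principalBundle {R : realType} {n k : nat}
    (M : manifoldType 'rV[R]_n) (G : lieGroupType 'rV[R]_k) := PrincipalBundle {
  total_dim : nat;
  total :> manifoldType 'rV[R]_total_dim;
  bundle_proj : total -> M;
  bundle_act : total -> G -> total;
  bundle_proj_smooth : smooth bundle_proj;
  bundle_act_smooth : smooth (fun z : total * G => bundle_act z.1 z.2);
  bundle_act1 : forall p, bundle_act p 1%g = p;
  bundle_actM : forall p g h,
    bundle_act (bundle_act p g) h = bundle_act p (g * h)%g;
  bundle_act_free : forall p g, bundle_act p g = p -> g = 1%g;
  bundle_proj_act : forall p g, bundle_proj (bundle_act p g) = bundle_proj p;
  locally_trivial : forall x : M, exists (U : set M) (phi : total -> G),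
    U x /\ local_trivialization bundle_proj bundle_act U phi
}.

Arguments bundle_proj {R n k M G}.
Arguments bundle_act {R n k M G P} : rename.

Section Fibred_product.
Context {R : realType} {n k : nat}.
Context {M : manifoldType 'rV[R]_n} {G : lieGroupType 'rV[R]_k}.
Variables P P' : principalBundle M G.

Definition fibprod : Type :=
  set_type [set z : P * P' | bundle_proj P z.1 = bundle_proj P' z.2].

HB.instance Definition _ := Topological.on fibprod.

(* The coordinates of (p, p') in M x G x G obtained from local                *)
(* trivializations phi of P and phi' of P' over the same open set U; these    *)
(* charts define the smooth structure of the embedded submanifold fibprod of  *)
(* P x P'.                                                                    *)
Definition fibprod_chart (U : set M) (phi : P -> G) (phi' : P' -> G)
    (a : chart M 'rV[R]_n) (b b' : chart G 'rV[R]_k) :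
    chart fibprod ('rV[R]_n * ('rV[R]_k * 'rV[R]_k)) :=
  Chart
    [set z : fibprod | let: (p, p') := set_val z in
       [/\ U (bundle_proj P p), chart_dom a (bundle_proj P p),
           chart_dom b (phi p) & chart_dom b' (phi' p')]]
    (fun z : fibprod => let: (p, p') := set_val z in
       (a (bundle_proj P p), (b (phi p), b' (phi' p')))).

HB.instance Definition _ :=
  hasAtlas.Build R ('rV[R]_n * ('rV[R]_k * 'rV[R]_k))%type fibprod
    [set c | exists U phi phi' a b b',
       [/\ local_trivialization (bundle_proj P) bundle_act U phi,
           local_trivialization (bundle_proj P') bundle_act U phi',
           atlas a, atlas b /\ atlas b'
         & c = fibprod_chart U phi phi' a b b']].

Lemma fibprod_act_subproof (z : fibprod) (g h : G) :
  (bundle_act (set_val z).1 g, bundle_act (set_val z).2 h)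
    \in [set z : P * P' | bundle_proj P z.1 = bundle_proj P' z.2].
Proof.
by apply/mem_set; rewrite /= !bundle_proj_act; exact: (set_valP z).
Qed.

Definition fibprod_act (z : fibprod) (gh : G * G) : fibprod :=
  SigSub (fibprod_act_subproof z gh.1 gh.2).

Definition bundle_morphisms : set (P -> P') :=
  [set sigma | [/\ smooth sigma,
                   forall p, bundle_proj P' (sigma p) = bundle_proj P p
                 & forall p g,
                     sigma (bundle_act p g) = bundle_act (sigma p) g]].

Definition equivariant_maps : set (fibprod -> G) :=
  [set K | smooth K /\
           forall z g h, K (fibprod_act z (g, h)) = (h^-1 * K z * g)%g].

End Fibred_product.

Arguments fibprod_act {R n k M G P P'}.
Arguments bundle_morphisms {R n k M G}.
Arguments equivariant_maps {R n k M G}.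

(* Main.v *)
Require Import Defs.
From HB Require Import structures.
From mathcomp Require Import all_boot all_order all_algebra.
From mathcomp Require Import all_classical all_reals all_analysis.
Set Implicit Arguments.
Unset Strict Implicit.
Unset Printing Implicit Defensive.
Import Order.TTheory GRing.Theory Num.Theory.
Import numFieldNormedType.Exports.
Local Open Scope classical_set_scope.
Local Open Scope ring_scope.

(** The group acts freely and transitively on the fibres of [P'], so a map
    [sigma] over the identity of [M] is the same thing as a function [K] on
    the fibred product, through the relation

      [sigma p = p' (K (p, p'))]        for all [(p, p')] in the fibred product.

    Freeness says that [K] is determined by [sigma], and transitivity that it
    exists. Since every fibre of [P'] is nonempty, [sigma] is determined by
    [K]; and a given [K] yields a [sigma] as soon as [p' (K (p, p'))] is the
    same for all [p'] in the fibre over [p], which is half of the equivariance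
    of [K], the other half being the equivariance of [sigma]. This
    is the content of [transition_equivariant], [transition_inj] and
    [transition_surj].

    What remains is that smoothness passes from one side to the other, which is
    local on [M]. Over an open set [U] with a trivialization [phi] of [P'], one
    has [K (p, p') = phi(p')^-1 phi(sigma p)]; and with the local section
    [s x = Psi (x, 1)] of [P'] one has [sigma p = s(x) (K (p, s(x)))], where [x]
    is the base point of [p]. Both right hand sides are compositions of smooth
    maps, so it suffices to know that smooth maps between spaces with charts
    compose and pair ([smooth_on_comp], [smooth_on_pair]), that
    smoothness is local ([smooth_on_local]), and that a map into the fibred
    product is smooth when its two components are ([smooth_on_fibprod]), the two
    projections being smooth themselves ([fibprod_fst_smooth],
    [fibprod_snd_smooth]).

    Smoothness being tested in charts, composition rests on the chain rule of
    order [k] for maps between finite-dimensional normed spaces ([Ck_on_comp]),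
    and on the fact that the charts of a product and of the fibred product are
    homeomorphisms onto open sets ([prod_charted_space],
    [fibprod_charted_space]). *)

(** * Calculus of maps of class C^k *)

Section Ck_calculus.
Context {R : realType}.
Implicit Types U V W : normedModType R.

(** Two maps with the same germ differ by a map that vanishes near the point,
    and such a map has differential zero. *)
Lemma near_eq_differentiable V W (f g : V -> W) (x : V) :
  (\near x, f x = g x) -> differentiable f x -> differentiable g x.
Proof.
move=> fg df.
have -> : g = f + (g - f) by rewrite addrC subrK.
apply: differentiableD => //; set h := g - f.
have h0 : \near x, h x = 0.
  by near=> y; rewrite /h !fctE (near fg y)// subrr.
have hx : h x = 0 by exact: (nbhs_singleton h0).
have zc : continuous (\0 : V -> W) by move=> y; exact: cst_continuous.
have ho : h \o shift x = cst (h x) + (\0 : V -> W) +o_ (0 : V) id.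
  apply/eqaddoP => e e0; move: h0; rewrite (near_shift 0) subr0.
  apply: filterS => y; rewrite !fctE /= hx => ->.
  by rewrite addr0 subrr normr0 mulr_ge0// ltW.
have dh : 'd h x = (\0 : V -> W) :> (V -> W) by exact: diff_unique.
by apply/diff_locallyP; rewrite dh.
Unshelve. all: by end_near.
Qed.

Lemma Ck_on_sub k V W (D D' : set V) (f : V -> W) :
  D' `<=` D -> Ck_on k D f -> Ck_on k D' f.
Proof.
elim: k f => [|k IH] f sD /=; first by move=> fc x /sD/fc.
by move=> [df Df]; split=> [x /sD/df //|v]; exact: IH.
Qed.

(** Being of class C^k on [D] only speaks of the points of [D] one by one, each
    derivative being taken in the whole space: this is what makes smoothness
    local without any gluing argument. *)
Lemma Ck_on_points k V W (D : set V) (f : V -> W) :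
  (forall x, D x -> Ck_on k [set x] f) -> Ck_on k D f.
Proof.
elim: k f => [|k IH] f /= fD; first by move=> x /fD; exact.
split=> [x /fD[+ _]|v]; first exact.
by apply: IH => x /fD[_]; exact.
Qed.

(** Equality on [D] would not be enough, since derivatives at a point of [D] see
    a neighbourhood of it. *)
Lemma Ck_on_ext k V W (D : set V) (f g : V -> W) :
  (forall x, D x -> \near x, f x = g x) -> Ck_on k D f -> Ck_on k D g.
Proof.
elim: k f g => [|k IH] f g fg /=.
  move=> fc x Dx; have gx := nbhs_singleton (fg x Dx).
  rewrite /prop_for /continuous_at -gx.
  by apply: cvg_trans (fc _ Dx); apply: near_eq_cvg; exact: fg.
move=> [df Df]; split=> [x Dx|v].
  exact: near_eq_differentiable (fg x Dx) (df x Dx).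
apply: IH (Df v) => x Dx; have /near_join := fg x Dx.
by apply: filterS => y fgy; exact: near_eq_derive.
Qed.

Lemma Ck_onS k V W (D : set V) (f : V -> W) : Ck_on k.+1 D f -> Ck_on k D f.
Proof.
elim: k f => [|k IH] f [df Df].
  by move=> x Dx; exact: differentiable_continuous (df x Dx).
by split=> // v; apply: IH.
Qed.

Lemma Ck_on_cst k V W (D : set V) (a : W) : Ck_on k D (cst a).
Proof.
elim: k a => [|k IH] a /=; first by move=> x _; exact: cst_continuous.
split=> [x _|v]; first exact: differentiable_cst.
rewrite (_ : 'D_v _ = cst 0)//; apply/funext => x.
by rewrite derive_val.
Qed.

Lemma Ck_on_linear k V W (D : set V) (f : {linear V -> W}) :
  continuous f -> Ck_on k D f.
Proof.
move=> fc; case: k => [|k] /=; first by move=> x _; exact: fc.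
split=> [x _|v]; first exact: linear_differentiable.
rewrite (_ : 'D_v _ = cst (f v)); first exact: Ck_on_cst.
apply/funext => x; rewrite deriveE ?diff_lin//.
exact: linear_differentiable.
Qed.

Lemma Ck_on_linear_comp k U V W (D : set U) (l : {linear V -> W}) (f : U -> V) :
  continuous l -> open D -> Ck_on k D f -> Ck_on k D (l \o f).
Proof.
move=> lc oD; elim: k f => [|k IH] f /=.
  by move=> fc x Dx; apply: continuous_comp; [exact: fc|exact: lc].
move=> [df Df]; have dl y := linear_differentiable y lc.
have dlf x : D x -> differentiable (l \o f) x.
  by move=> Dx; apply: differentiable_comp => //; exact: df.
split=> // v; apply: Ck_on_ext (IH _ (Df v)) => x Dx.
have : nbhs x D by exact: open_nbhs_nbhs.
apply: filterS => y Dy; have dfy := df y Dy; have dlfy := dlf y Dy.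
by rewrite (deriveE _ dlfy) diff_comp//= diff_lin// deriveE.
Qed.

Lemma Ck_onD k V W (D : set V) (f g : V -> W) : open D ->
  Ck_on k D f -> Ck_on k D g -> Ck_on k D (f + g).
Proof.
move=> oD; elim: k f g => [|k IH] f g /=.
  by move=> fc gc x Dx; apply: continuousD; [exact: fc|exact: gc].
move=> [df Df] [dg Dg]; split=> [x Dx|v].
  by apply: differentiableD; [exact: df|exact: dg].
apply: Ck_on_ext (IH _ _ (Df v) (Dg v)) => x Dx.
have : nbhs x D by exact: open_nbhs_nbhs.
apply: filterS => y Dy; rewrite deriveD//.
  by apply: diff_derivable; exact: df.
by apply: diff_derivable; exact: dg.
Qed.

Lemma Ck_on_sum k V W (D : set V) I (r : seq I) (f : I -> V -> W) : open D ->
  (forall i, Ck_on k D (f i)) -> Ck_on k D (\sum_(i <- r) f i).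
Proof.
move=> oD fi; elim: r => [|i r IH]; first by rewrite big_nil; exact: Ck_on_cst.
by rewrite big_cons; exact: Ck_onD.
Qed.

Lemma Ck_on_pair k U V W (D : set U) (f : U -> V) (g : U -> W) : open D ->
  Ck_on k D f -> Ck_on k D g -> Ck_on k D (fun x => (f x, g x)).
Proof.
move=> oD; elim: k f g => [|k IH] f g /=.
  by move=> fc gc x Dx; apply: cvg_pair; [exact: fc|exact: gc].
move=> [df Df] [dg Dg]; split=> [x Dx|v].
  by apply: differentiable_pair; [exact: df|exact: dg].
apply: Ck_on_ext (IH _ _ (Df v) (Dg v)) => x Dx.
have : nbhs x D by exact: open_nbhs_nbhs.
apply: filterS => y Dy; rewrite !deriveE ?diff_pair//.
all: by [exact: df|exact: dg|apply: differentiable_pair; [exact: df|exact: dg]].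
Qed.

(** The product rule, read off the differential of the bilinear map
    [(a, w) |-> a *: w]. *)
Lemma scale_differentiable V W (f : V -> R^o) (g : V -> W) x :
  differentiable f x -> differentiable g x ->
  differentiable (fun y => f y *: g y) x /\
  forall v, 'D_v (fun y => f y *: g y) x = f x *: 'D_v g x + 'D_v f x *: g x.
Proof.
move=> df dg; pose s (a : R^o) (w : W) : W := a *: w.
have s_bil : bilinear_for (GRing.Scale.Law.clone _ _ *:%R _)
    (GRing.Scale.Law.clone _ _ *:%R _) s.
  split=> [w a b c|a b v w] /=; first by rewrite /s scalerDl scalerA.
  by rewrite /s scalerDr !scalerA mulrC.
pose sB : {bilinear R^o -> W -> W} :=
  HB.pack s (bilinear_isBilinear.Build R R^o W W _ _ s s_bil).
have sc : continuous (fun p : R^o * W => sB p.1 p.2) by exact: scale_continuous.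
have ds p := differentiable_bilin p sc.
have dfg := differentiable_pair df dg.
pose S (p : R^o * W) := sB p.1 p.2.
have -> : (fun y => f y *: g y) = S \o (fun y => (f y, g y)) by [].
have dsfg : differentiable (S \o (fun y => (f y, g y))) x.
  exact: differentiable_comp.
split=> // v; rewrite !deriveE//.
have -> : 'd (S \o (fun y => (f y, g y))) x v =
    'd S (f x, g x) ('d (fun y => (f y, g y)) x v) by rewrite diff_comp.
by rewrite /S diff_bilin// diff_pair.
Qed.

Lemma Ck_onZ k V W (D : set V) (f : V -> R^o) (g : V -> W) : open D ->
  Ck_on k D f -> Ck_on k D g -> Ck_on k D (fun x => f x *: g x).
Proof.
move=> oD; elim: k f g => [|k IH] f g.
  by move=> fc gc x Dx; apply: cvgZ; [exact: fc|exact: gc].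
move=> fk gk; have [df Df] := fk; have [dg Dg] := gk.
split=> [x Dx|v].
  by have [] := scale_differentiable (df x Dx) (dg x Dx).
apply: (@Ck_on_ext _ _ _ _
  ((fun x => f x *: 'D_v g x) + (fun x => 'D_v f x *: g x))).
  move=> x Dx; have : nbhs x D by exact: open_nbhs_nbhs.
  apply: filterS => y Dy.
  by have [_ ->] := scale_differentiable (df y Dy) (dg y Dy).
by apply: Ck_onD => //; apply: IH; [exact: Ck_onS|exact: Dg|exact: Df|exact: Ck_onS].
Qed.

(** The coordinates are required to be continuous, as they automatically are in
    finite dimension, so that they can be composed with C^k maps at once. *)
Definition finite_dimensional V : Prop :=
  exists (I : finType) (e : I -> V) (l : I -> {linear V -> R^o}),
    (forall i, continuous (l i)) /\ forall v, v = \sum_i l i v *: e i.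

Lemma finite_dimensional_rV n : finite_dimensional 'rV[R]_n.
Proof.
exists 'I_n, (fun i => delta_mx 0 i).
have lin i : linear (fun v : 'rV[R]_n => v 0 i : R^o).
  by move=> a u v; rewrite !mxE.
pose l i : {linear 'rV[R]_n -> R^o} :=
  HB.pack (fun v : 'rV[R]_n => v 0 i : R^o)
    (GRing.isLinear.Build R 'rV[R]_n R^o _ _ (lin i)).
exists l; split.
  by move=> i; exact: coord_continuous.
by move=> v; exact: row_sum_delta.
Qed.

Lemma finite_dimensional_prod V W : finite_dimensional V ->
  finite_dimensional W -> finite_dimensional (V * W)%type.
Proof.
move=> [I [e [l [lc eE]]]] [J [f [m [mc fE]]]].
exists (I + J)%type, (fun s => match s with inl i => (e i, 0) | inr j => (0, f j) end).
pose fstL : {linear (V * W)%type -> V} := fst.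
pose sndL : {linear (V * W)%type -> W} := snd.
exists (fun s => match s return {linear (V * W)%type -> R^o} with
  inl i => l i \o fstL | inr j => m j \o sndL end).
split.
  case=> i z /=; apply: continuous_comp; [exact: cvg_fst|exact: lc
    |exact: cvg_snd|exact: mc].
move=> [v w]; rewrite big_sumType/=.
apply: injective_projections.
  rewrite -[RHS]/(fstL _) linearD !linear_sum/= [X in _ + X]big1 ?addr0//=.
  by move=> j _; rewrite scaler0.
rewrite -[RHS]/(sndL _) linearD !linear_sum/= big1 ?add0r//=.
by move=> i _; rewrite scaler0.
Qed.

(** The chain rule reads ['D_v (g \o f) = \sum_i l_i('D_v f) *: ('D_(e_i) g \o f)]
    in a basis [e] of the middle space with coordinates [l]. The basis is what
    makes the induction on [k] go through: each term is a product of a C^k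
    function by a composition of C^k maps. *)
Lemma Ck_on_comp k U V W (D : set U) (D' : set V) (f : U -> V) (g : V -> W) :
  finite_dimensional V -> open D -> open D' -> (forall x, D x -> D' (f x)) ->
  Ck_on k D f -> Ck_on k D' g -> Ck_on k D (g \o f).
Proof.
move=> [I [e [l [lc eE]]]] oD oD' fD.
elim: k f g fD => [|k IH] f g fD fk gk.
  move=> x Dx; apply: continuous_comp; first exact: fk.
  by apply: gk; exact: fD.
have [df Df] := fk; have [dg Dg] := gk.
split=> [x Dx|v].
  by apply: differentiable_comp; [exact: df|apply: dg; exact: fD].
apply: (@Ck_on_ext _ _ _ _
  (\sum_i (fun x => l i ('D_v f x) *: 'D_(e i) g (f x)))).
  move=> x Dx; have : nbhs x D by exact: open_nbhs_nbhs.
  apply: filterS => y Dy; have dfy := df y Dy; have dgy := dg _ (fD y Dy).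
  rewrite fct_sumE (deriveE _ (differentiable_comp dfy dgy)) diff_comp//=.
  rewrite -(deriveE v dfy) [in RHS](eE ('D_v f y)) linear_sum/=.
  by apply: eq_bigr => i _; rewrite (deriveE (e i) dgy) -linearZ.
apply: Ck_on_sum => // i; apply: Ck_onZ => //.
  by apply: Ck_on_linear_comp => //; exact: Df.
by apply: (IH f ('D_(e i) g)); [exact: fD|exact: Ck_onS|exact: Dg].
Qed.

End Ck_calculus.

(** * Charts as local homeomorphisms *)

Section Topology.
Context {X Y : topologicalType}.

Lemma open_setI_preimage (D : set X) (f : X -> Y) (A : set Y) : open D ->
  (forall x, D x -> {for x, continuous f}) -> open A -> open (D `&` f @^-1` A).
Proof.
move=> oD fc oA; rewrite openE => x [Dx Afx].
apply: filterI; first exact: open_nbhs_nbhs.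
by apply: fc => //; exact: open_nbhs_nbhs.
Qed.

Lemma open_setX (A : set X) (B : set Y) : open A -> open B -> open (A `*` B).
Proof.
move=> oA oB; rewrite openE => -[x y] [/= Ax By].
by exists (A, B) => //; split; exact: open_nbhs_nbhs.
Qed.

Lemma continuous_pair (Z : topologicalType) (f : X -> Y) (g : X -> Z) (x : X) :
  {for x, continuous f} -> {for x, continuous g} ->
  {for x, continuous (fun t => (f t, g t))}.
Proof. by move=> fx gx; exact: cvg_pair. Qed.

Lemma continuous_set_val (A : set X) (f : Y -> A) (y : Y) :
  {for y, continuous (fun t => set_val (f t))} -> {for y, continuous f}.
Proof.
by move=> fc U /= [_ [[W oW <-] Wx sWU]]; apply: filterS sWU _; apply: fc;
  exact: open_nbhs_nbhs.
Qed.

Lemma set_val_continuous (A : set X) : continuous (set_val : A -> X).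
Proof. exact: initial_continuous. Qed.

End Topology.

Section Charts.
Context {R : realType} {E : normedModType R} {X : topologicalType}.
Variables (c : chart X E) (c_chart : is_chart c).

Let oc : open (chart_dom c). Proof. by case: c_chart. Qed.

Lemma chart_invK x0 x : chart_dom c x -> chart_inv c x0 (c x) = x.
Proof. by move=> cx; apply: pinvKV; rewrite ?inE//; case: c_chart. Qed.

Lemma chart_image_open (U : set X) :
  open U -> U `<=` chart_dom c -> open (c @` U).
Proof. by case: c_chart => _ _ _; exact. Qed.

Lemma chart_inv_continuous x0 x :
  chart_dom c x -> {for c x, continuous (chart_inv c x0)}.
Proof.
move=> cx V; rewrite chart_invK// nbhsE => -[W [oW Wx] sWV].
have : open_nbhs (c x) (c @` (W `&` chart_dom c)).
  by split; [apply: chart_image_open; [exact: openI|exact: subIsetr]|exists x].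
move=> /open_nbhs_nbhs; apply: filterS => _ [y [Wy cy] <-] /=.
by rewrite chart_invK//; exact: sWV.
Qed.

(** The form in which smoothness in a chart is checked below: at each point the
    map [h] may be replaced by another expression [g] valid on an open piece [N]
    of the domain of the chart. *)
Lemma Cinfty_on_chart (F : normedModType R) (D : set X) (h : E -> F) :
  (forall x, D x -> exists N (g : E -> F), [/\ open N, N x, N `<=` chart_dom c,
     forall y, N y -> h (c y) = g (c y) & Cinfty_on (c @` N) g]) ->
  Cinfty_on (c @` D) h.
Proof.
move=> hD k; apply: Ck_on_points => _ [x Dx <-].
have [N [g [oN Nx sN hg gN]]] := hD x Dx.
apply: (@Ck_on_ext _ _ _ _ _ g) => [_ ->|]; last first.
  by apply: Ck_on_sub (gN k) => _ ->; exists x.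
have : open_nbhs (c x) (c @` N) by split; [exact: chart_image_open|exists x].
by move=> /open_nbhs_nbhs; apply: filterS => _ [y Ny <-]; rewrite hg.
Qed.

End Charts.

(** * Smooth maps between spaces with charts *)

Section Smooth.
Context {R : realType}.

(** Common to manifolds, their products and the fibred product: what allows
    points to be moved to the model space and back. *)
Definition charted_space {E : normedModType R} (X : chartedType E) : Prop :=
  (forall c : chart X E, atlas c -> is_chart c) /\
  (forall x : X, exists2 c : chart X E, atlas c & chart_dom c x).

Lemma manifold_charted_space (E : normedModType R) (X : manifoldType E) :
  charted_space X.
Proof. by split; [exact: atlas_chart|exact: atlas_cover]. Qed.

Lemma prod_charted_space (E F : normedModType R) (X : chartedType E)
    (Y : chartedType F) :
  charted_space X -> charted_space Y -> charted_space (X * Y)%type.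
Proof.
move=> [Xc Xcov] [Yc Ycov]; split; last first.
  move=> [x y]; have [c cX cx] := Xcov x; have [d dY dy] := Ycov y.
  by exists (prod_chart c d) => //; exists (c, d).
move=> _ [[c d] [/= /Xc cc /Yc dc] <-]; case: (cc) => oc injc cc' _.
case: (dc) => od injd dc' _; split => /=.
- exact: open_setX.
- move=> [x y] [x' y']; rewrite !inE => -[/= cx dy] [/= cx' dy'] [e1 e2].
  by congr pair; [apply: injc|apply: injd]; rewrite ?inE.
- move=> [x y] [/= cx dy].
  apply: (@cvg_pair _ _ _ _ (nbhs (c x)) (nbhs (d y))) => /=.
    by apply: (@continuous_comp _ _ _ fst c (x, y)); [exact: cvg_fst|exact: cc'].
  by apply: (@continuous_comp _ _ _ snd d (x, y)); [exact: cvg_snd|exact: dc'].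
- move=> U oU sU; rewrite openE => _ [[x y] Uxy <-] /=.
  have [cx dy] := sU _ Uxy.
  have : nbhs (x, y) U by exact: open_nbhs_nbhs.
  move=> -[[A B] /= [Ax By] sAB].
  move: Ax By; rewrite !nbhsE => -[A' [oA' A'x] sA] [B' [oB' B'y] sB].
  exists (c @` (A' `&` chart_dom c), d @` (B' `&` chart_dom d)) => /=.
    split; apply: open_nbhs_nbhs; split.
    - by apply: (chart_image_open cc); [exact: openI|exact: subIsetr].
    - by exists x.
    - by apply: (chart_image_open dc); [exact: openI|exact: subIsetr].
    - by exists y.
  move=> [u v] /= [[x' [Ax' _] <-] [y' [By' _] <-]].
  by exists (x', y') => //; apply: sAB; split; [exact: sA|exact: sB].
Qed.

Section General.
Context {E F : normedModType R} {X : chartedType E} {Y : chartedType F}.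
Implicit Types (D : set X) (f g : X -> Y).

Lemma smooth_on_sub D D' f : D' `<=` D -> smooth_on D f -> smooth_on D' f.
Proof.
move=> sD [fc fs]; split=> [x /sD/fc//|c d cX dY /= x0 [[D'x0 cx0] dx0] k].
have h : [set x | (D `&` chart_dom c `&` f @^-1` chart_dom d) x] x0.
  by split=> //; split=> //; exact: sD.
apply: Ck_on_sub (fs c d cX dY x0 h k).
by move=> _ [x [[D'x cx] dx] <-]; exists x => //; split=> //; split=> //; exact: sD.
Qed.

Hypotheses (Xc : charted_space X) (Yc : charted_space Y).

Lemma smooth_on_domain_open D f (c : chart X E) (d : chart Y F) :
  atlas c -> atlas d -> open D -> smooth_on D f ->
  open (D `&` chart_dom c `&` f @^-1` chart_dom d).
Proof.
move=> cX dY oD [fc _]; apply: open_setI_preimage.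
- by apply: openI => //; have [] := Xc.1 c cX.
- by move=> x [Dx _]; exact: fc.
- by have [] := Yc.1 d dY.
Qed.

(** Gluing and congruence in one statement: [f] may be given by a different
    smooth formula [g] around each point. *)
Lemma smooth_on_local D f :
  (forall x, D x -> exists N g, [/\ open N, N x,
     forall y, N y -> f y = g y & smooth_on N g]) -> smooth_on D f.
Proof.
move=> fD; split=> [x /fD[N [g [oN Nx fg [gc _]]]]|c d cX dY /= x0 _].
  rewrite /prop_for /continuous_at fg//; apply: cvg_trans (gc x Nx).
  apply: near_eq_cvg; apply: filterS (open_nbhs_nbhs (conj oN Nx)).
  by move=> y /fg ->.
have cc := Xc.1 c cX; apply: Cinfty_on_chart => //.
move=> x [[Dx cx] dx]; have [N [g [oN Nx fg gs]]] := fD x Dx.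
pose D' := N `&` chart_dom c `&` g @^-1` chart_dom d.
have D'x : D' x by split=> //; rewrite /= -fg.
exists D', (d \o g \o chart_inv c x); split=> //.
- exact: smooth_on_domain_open.
- by move=> y [[]].
- by move=> y [[Ny cy] dy] /=; rewrite !chart_invK// fg.
- exact: gs.2.
Qed.

Lemma smooth_on_cst D (y : Y) : smooth_on D (cst y : X -> Y).
Proof.
split=> [x _|c d cX dY /= x0 _ k]; first exact: cst_continuous.
exact: (Ck_on_cst _ _ (d y)).
Qed.

End General.

(** In charts the identity is a change of charts. *)
Lemma smooth_on_id (E : normedModType R) (X : manifoldType E) (D : set X) :
  smooth_on D (id : X -> X).
Proof.
split=> [x _|c d cX dX /= x0 [[_ cx0] dx0] k]; first exact: cvg_id.
apply: Ck_on_sub (atlas_compatible c d cX dX x0 (conj cx0 dx0) k).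
by move=> _ [x [[_ cx] dx] <-]; exists x.
Qed.

(** Around [x], insert a chart [d] at [f x] between the two maps. The open
    sets [A] and [B] cut the domains down to where all three charts are
    defined. *)
Lemma smooth_on_comp (E F H : normedModType R) (X : chartedType E)
    (Y : chartedType F) (Z : chartedType H) (D : set X) (D' : set Y)
    (f : X -> Y) (g : Y -> Z) :
  charted_space X -> charted_space Y -> charted_space Z ->
  finite_dimensional F -> open D -> open D' -> (forall x, D x -> D' (f x)) ->
  smooth_on D f -> smooth_on D' g -> smooth_on D (g \o f).
Proof.
move=> Xc Yc Zc Ffd oD oD' fD fs gs; split=> [x Dx|c e cX eZ /= x0 _].
  by apply: continuous_comp; [exact: fs.1|exact: gs.1 (fD x Dx)].
have cc := Xc.1 c cX; apply: Cinfty_on_chart => //.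
move=> x [[Dx cx] ex]; have [d dY dfx] := Yc.2 (f x).
have dd := Yc.1 d dY.
pose B := D' `&` chart_dom d `&` g @^-1` chart_dom e.
have oB : open B by exact: smooth_on_domain_open.
have Bfx : B (f x) by split=> //; split=> //; exact: fD.
pose A := D `&` chart_dom c `&` f @^-1` chart_dom d.
have oA : open A by exact: smooth_on_domain_open.
pose N := A `&` f @^-1` B.
have oN : open N by apply: open_setI_preimage => // y [[Dy _] _]; exact: fs.1.
exists N, ((e \o g \o chart_inv d (f x)) \o (d \o f \o chart_inv c x)).
split=> //.
- by move=> y [[[]]].
- by move=> y [[[Dy cy] dy] By] /=; rewrite !chart_invK.
- have sN : N `<=` chart_dom c by move=> y [[[]]].
  move=> k; apply: (Ck_on_comp (D' := d @` B)) => //.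
  + exact: chart_image_open.
  + by apply: chart_image_open => // y [[]].
  + move=> _ [y [[[Dy cy] dy] By] <-] /=; exists (f y) => //.
    by rewrite chart_invK.
  + have Ax : A x by [].
    by apply: Ck_on_sub (fs.2 c d cX dY x Ax k) => _ [y [Ay _] <-]; exists y.
  + exact: gs.2 d e dY eZ (f x) Bfx k.
Qed.

Lemma smooth_on_pair (E F H : normedModType R) (X : chartedType E)
    (Y : chartedType F) (Z : chartedType H) (D : set X)
    (f : X -> Y) (g : X -> Z) :
  charted_space X -> charted_space Y -> charted_space Z -> open D ->
  smooth_on D f -> smooth_on D g -> smooth_on D (fun x => (f x, g x)).
Proof.
move=> Xc Yc Zc oD fs gs; split=> [x Dx|c _ cX [[d e] [/= dY eZ] <-] /= x0].
  by apply: cvg_pair; [exact: fs.1|exact: gs.1].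
move=> D'x0 k; apply: Ck_on_pair.
- pose D' := D `&` chart_dom c `&`
    (fun x => (f x, g x)) @^-1` (chart_dom d `*` chart_dom e).
  rewrite -[X in c @` X]/D'.
  have -> : D' = (D `&` chart_dom c `&` f @^-1` chart_dom d) `&`
      (D `&` chart_dom c `&` g @^-1` chart_dom e).
    apply/seteqP; split=> x; first by move=> [[? ?] [? ?]].
    by move=> [[[? ?] ?] [_ ?]].
  apply: chart_image_open; first exact: Xc.1.
    by apply: openI; exact: smooth_on_domain_open.
  by move=> x [[[]]].
- have [Dc [dx0 ex0]] := D'x0.
  apply: Ck_on_sub (fs.2 c d cX dY x0 (conj Dc dx0) k).
  by move=> _ [x [? [? ?]] <-]; exists x.
- have [Dc [dx0 ex0]] := D'x0.
  apply: Ck_on_sub (gs.2 c e cX eZ x0 (conj Dc ex0) k).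
  by move=> _ [x [? [? ?]] <-]; exists x.
Qed.

(** In the product charts, the second projection is the linear projection
    followed by a change of charts of the second factor. *)
Lemma smooth_on_snd (E F : normedModType R) (X : chartedType E)
    (Y : manifoldType F) (D : set (X * Y)) :
  charted_space X -> finite_dimensional F -> open D ->
  smooth_on D (snd : X * Y -> Y).
Proof.
move=> Xc Ffd oD; have Yc := manifold_charted_space Y.
have XYc := prod_charted_space Xc Yc.
split=> [x _|cd d' cdXY d'Y /= z0 _]; first exact: cvg_snd.
have cdc := XYc.1 cd cdXY; apply: Cinfty_on_chart => //.
case: cdXY cdc => -[c d] [/= cX dY] <- cdc [x y] [[Dxy [/= cx dy]] d'y].
pose N := snd @^-1` (chart_dom d `&` chart_dom d') `&` chart_dom (prod_chart c d).
have oN : open N.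
  apply: openI; last by case: cdc.
  apply: open_comp => [? _|]; first exact: cvg_snd.
  by apply: openI; [have [] := Yc.1 d dY|have [] := Yc.1 d' d'Y].
exists N, ((d' \o chart_inv d y) \o snd); split=> //.
- exact: subIsetr.
- move=> z [[dz d'z] z']; rewrite /comp (chart_invK cdc z0 z') /=.
  by rewrite (chart_invK (Yc.1 d dY)).
- move=> k; apply: (Ck_on_comp (D' := d @` (chart_dom d `&` chart_dom d'))) => //.
  + by apply: (chart_image_open cdc oN); exact: subIsetr.
  + apply: (chart_image_open (Yc.1 d dY)); last exact: subIsetl.
    by apply: openI; [have [] := Yc.1 d dY|have [] := Yc.1 d' d'Y].
  + by move=> _ [z [z2 _] <-] /=; exists z.2.
  + by apply: Ck_on_linear => ?; exact: cvg_snd.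
  + exact: atlas_compatible.
Qed.

End Smooth.

(** * Principal bundles *)

Section Bundle.
Context {R : realType} {n k : nat}.
Context {M : manifoldType 'rV[R]_n} {G : lieGroupType 'rV[R]_k}.
Variable P : principalBundle M G.
Let pi := bundle_proj P.
Let act : P -> G -> P := bundle_act.
Implicit Types (U : set M) (phi : P -> G).

Lemma bundle_proj_continuous : continuous (bundle_proj P).
Proof. by move=> p; exact: (bundle_proj_smooth P).1. Qed.

Lemma open_bundle_proj_preimage U : open U -> open (pi @^-1` U).
Proof. by apply: open_comp => p _; exact: bundle_proj_continuous. Qed.

Lemma trivialization_smooth U phi :
  local_trivialization pi act U phi -> smooth_on (pi @^-1` U) phi.
Proof.
move=> [oU Phis _ _].
have Mc := manifold_charted_space M; have Gc := manifold_charted_space G.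
apply: (@smooth_on_comp _ _ _ _ _ _ _ _ setT (fun p => (pi p, phi p)) snd) => //.
- exact: manifold_charted_space.
- exact: prod_charted_space.
- by apply: finite_dimensional_prod; exact: finite_dimensional_rV.
- exact: open_bundle_proj_preimage.
- exact: openT.
- apply: smooth_on_snd => //; first exact: finite_dimensional_rV.
  exact: openT.
Qed.

Lemma trivialization_sub U V phi : open V -> V `<=` U ->
  local_trivialization pi act U phi -> local_trivialization pi act V phi.
Proof.
move=> oV sV [oU Phis phiG [Psi [Psis PsiPhi PhiPsi]]]; split=> //.
- by apply: smooth_on_sub Phis => p /sV.
- by move=> p g /sV; exact: phiG.
- exists Psi; split; first by apply: smooth_on_sub Psis => z [/sV].
    by move=> p /sV; exact: PsiPhi.
  by move=> z /sV; exact: PhiPsi.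
Qed.

Lemma bundle_act_inj p g h : act p g = act p h -> g = h.
Proof.
move=> e; have /bundle_act_free : act p (g * h^-1)%g = p.
  by rewrite /act -bundle_actM -/(act p g) e /act bundle_actM mulgV bundle_act1.
by move=> /(congr1 (fun x => x * h)%g); rewrite mulgVK mul1g.
Qed.

(** In a trivialization, two points of a fibre differ by an element of [G], and
    the trivialization is injective. *)
Lemma bundle_act_transitive p q : pi p = pi q -> exists g, q = act p g.
Proof.
move=> pq; have [U [phi [Uq [_ _ phiG [Psi [_ PsiPhi _]]]]]] :=
  locally_trivial P (pi q).
exists ((phi p)^-1 * phi q)%g; rewrite -[LHS]PsiPhi// -[RHS]PsiPhi; last first.
  by rewrite bundle_proj_act -/pi pq.
rewrite bundle_proj_act phiG ?mulVKg -/pi ?pq//.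
Qed.

(** If the coordinates of [f x] in a trivialization are a linear function [l] of
    those of [x] in the chart [c], then [f] is in this chart the composition of
    [l] with the inverse [Psi] of the trivialization. This is how
    the two projections of the fibred product look. *)
Lemma smooth_into_bundle (E : normedModType R) (X : chartedType E) (f : X -> P)
    (c : chart X E) U phi (a : chart M 'rV[R]_n) (b : chart G 'rV[R]_k)
    (l : {linear E -> ('rV[R]_n * 'rV[R]_k)%type}) (d : chart P _) (x0 : X) :
  is_chart c -> local_trivialization pi act U phi -> atlas a -> atlas b ->
  continuous f -> continuous l ->
  (forall x, chart_dom c x ->
    [/\ U (pi (f x)), chart_dom a (pi (f x)), chart_dom b (phi (f x))
      & l (c x) = (a (pi (f x)), b (phi (f x)))]) ->
  atlas d ->
  Cinfty_on (c @` (chart_dom c `&` f @^-1` chart_dom d))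
    (d \o f \o chart_inv c x0).
Proof.
move=> cc [oU _ _ [Psi [Psis PsiPhi PhiPsi]]] aM bG fc lc cl dP.
have Mc := manifold_charted_space M; have Gc := manifold_charted_space G.
have Pc := manifold_charted_space P; have MGc := prod_charted_space Mc Gc.
pose ab := prod_chart a b.
have abMG : atlas ab by exists (a, b).
pose D' := (U `*` setT) `&` chart_dom ab `&` Psi @^-1` chart_dom d.
have oD' : open D'.
  by apply: smooth_on_domain_open => //; apply: open_setX => //; exact: openT.
pose N := chart_dom c `&` f @^-1` chart_dom d.
have oN : open N.
  by apply: open_setI_preimage; [case: cc|move=> y _; exact: fc|have [] := Pc.1 d dP].
apply: Cinfty_on_chart => // x Nx.
have D'N y : N y -> D' (pi (f y), phi (f y)).
  by move=> [/cl[Uy ay by_ _] dy]; split=> //; rewrite /preimage /= PsiPhi.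
exists N, ((d \o Psi \o chart_inv ab (pi (f x), phi (f x))) \o l); split=> //.
- by move=> y [].
- move=> y Ny; have [/cl[Uy ay by_ ly] dy] := Ny.
  have aby : chart_dom ab (pi (f y), phi (f y)) by [].
  rewrite /comp (chart_invK cc _ Ny.1) ly.
  rewrite -[X in chart_inv ab _ X]/(ab (pi (f y), phi (f y))).
  by rewrite (chart_invK (MGc.1 _ abMG) _ aby) PsiPhi.
- move=> j; apply: (Ck_on_comp (D' := ab @` D')).
  + by apply: finite_dimensional_prod; exact: finite_dimensional_rV.
  + by apply: chart_image_open => // y [].
  + by apply: (chart_image_open (MGc.1 _ abMG) oD') => y [[]].
  + move=> _ [y Ny <-]; exists (pi (f y), phi (f y)); first exact: D'N.
    by have [_ _ _ ->] := cl y Ny.1.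
  + exact: Ck_on_linear.
  + exact: Psis.2 ab d abMG dP _ (D'N x Nx) j.
Qed.

End Bundle.

(** * The fibred product *)

Section Fibprod.
Context {R : realType} {n k : nat}.
Context {M : manifoldType 'rV[R]_n} {G : lieGroupType 'rV[R]_k}.
Variables P P' : principalBundle M G.
Local Notation fibprod := (fibprod P P').

Definition fibprod_fst (z : fibprod) : P := (set_val z).1.
Definition fibprod_snd (z : fibprod) : P' := (set_val z).2.

Lemma fibprod_proj z :
  bundle_proj P (fibprod_fst z) = bundle_proj P' (fibprod_snd z).
Proof. exact: set_valP z. Qed.

Definition fibprod_mk (p : P) (q : P')
    (pq : bundle_proj P p = bundle_proj P' q) : fibprod :=
  SigSub (mem_set (pq : [set z : P * P' | bundle_proj P z.1 = bundle_proj P' z.2] (p, q))).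

Lemma fibprod_eq (z w : fibprod) : fibprod_fst z = fibprod_fst w ->
  fibprod_snd z = fibprod_snd w -> z = w.
Proof.
move=> e1 e2; apply: val_inj; exact: injective_projections.
Qed.

Lemma fibprod_fst_continuous : continuous fibprod_fst.
Proof.
move=> z; apply: (@continuous_comp _ _ _ (set_val : fibprod -> _) fst).
  exact: set_val_continuous.
exact: cvg_fst.
Qed.

Lemma fibprod_snd_continuous : continuous fibprod_snd.
Proof.
move=> z; apply: (@continuous_comp _ _ _ (set_val : fibprod -> _) snd).
  exact: set_val_continuous.
exact: cvg_snd.
Qed.

Lemma fibprod_chartP U phi phi' a b b' (z : fibprod) :
  let c := fibprod_chart U phi phi' a b b' in
  c z = (a (bundle_proj P (fibprod_fst z)),
    (b (phi (fibprod_fst z)), b' (phi' (fibprod_snd z)))) /\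
  (chart_dom c z <-> [/\ U (bundle_proj P (fibprod_fst z)),
    chart_dom a (bundle_proj P (fibprod_fst z)),
    chart_dom b (phi (fibprod_fst z)) & chart_dom b' (phi' (fibprod_snd z))]).
Proof.
by rewrite /= /fibprod_fst /fibprod_snd; case: (set_val z).
Qed.

Lemma fibprod_atlas_cover (z : fibprod) :
  exists2 c : chart fibprod _, atlas c & chart_dom c z.
Proof.
have Mc := manifold_charted_space M; have Gc := manifold_charted_space G.
have [U [phi [Uz trU]]] := locally_trivial P (bundle_proj P (fibprod_fst z)).
have [U' [phi' [U'z trU']]] := locally_trivial P' (bundle_proj P' (fibprod_snd z)).
have oV : open (U `&` U') by apply: openI; [case: trU|case: trU'].
have [a aM az] := Mc.2 (bundle_proj P (fibprod_fst z)).
have [b bG bz] := Gc.2 (phi (fibprod_fst z)).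
have [b' b'G b'z] := Gc.2 (phi' (fibprod_snd z)).
exists (fibprod_chart (U `&` U') phi phi' a b b').
  exists (U `&` U'), phi, phi', a, b, b'; split=> //.
    by apply: trivialization_sub trU => //; exact: subIsetl.
  by apply: trivialization_sub trU' => //; exact: subIsetr.
by have [_ ->] := fibprod_chartP (U `&` U') phi phi' a b b' z;
  split=> //; split=> //; rewrite fibprod_proj.
Qed.

(** The inverse of the chart sends [(a x, (b y, b' y'))] to
    [(Psi (x, y), Psi' (x, y'))]; as a map [r] into [P * P'] it is continuous on
    the product [B] of the images of the three charts, which makes the image of an
    open set open. *)
Lemma fibprod_chart_is_chart U phi phi' a b b' :
  local_trivialization (bundle_proj P) bundle_act U phi ->
  local_trivialization (bundle_proj P') bundle_act U phi' ->
  atlas a -> atlas b -> atlas b' ->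
  is_chart (fibprod_chart U phi phi' a b b' : chart fibprod _).
Proof.
move=> trU trU' aM bG b'G.
have Mc := manifold_charted_space M; have Gc := manifold_charted_space G.
set c := fibprod_chart _ _ _ _ _ _.
have cE z : c z = (a (bundle_proj P (fibprod_fst z)),
    (b (phi (fibprod_fst z)), b' (phi' (fibprod_snd z)))).
  by have [] := fibprod_chartP U phi phi' a b b' z.
(* The trivializations are only continuous over [U], so the conditions on their
   values come after the one on the base point. *)
pose D0 := setT `&` (bundle_proj P \o fibprod_fst) @^-1` (U `&` chart_dom a).
pose D1 := D0 `&` (phi \o fibprod_fst) @^-1` chart_dom b.
pose D2 := D1 `&` (phi' \o fibprod_snd) @^-1` chart_dom b'.
have domE : chart_dom c = D2.
  apply/seteqP; split=> z; rewrite (fibprod_chartP U phi phi' a b b' z).2.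
    by move=> [].
  by move=> [[[_ [? ?]] ?] ?].
have oU : open U by case: trU.
have ac := Mc.1 a aM; have bc := Gc.1 b bG; have b'c := Gc.1 b' b'G.
have pi_cont (z : fibprod) : {for z, continuous (bundle_proj P \o fibprod_fst)}.
  by apply: continuous_comp;
    [exact: fibprod_fst_continuous|exact: bundle_proj_continuous].
have phi_cont (z : fibprod) : U (bundle_proj P (fibprod_fst z)) ->
    {for z, continuous (phi \o fibprod_fst)}.
  move=> Uz; apply: continuous_comp; first exact: fibprod_fst_continuous.
  exact: (trivialization_smooth trU).1.
have phi'_cont (z : fibprod) : U (bundle_proj P (fibprod_fst z)) ->
    {for z, continuous (phi' \o fibprod_snd)}.
  move=> Uz; apply: continuous_comp; first exact: fibprod_snd_continuous.
  by apply: (trivialization_smooth trU').1; rewrite /preimage /= -fibprod_proj.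
have oa : open (chart_dom a) by case: ac.
have ob : open (chart_dom b) by case: bc.
have ob' : open (chart_dom b') by case: b'c.
have oD0 : open D0.
  by apply: open_setI_preimage => //; [exact: openT|exact: openI].
have oD1 : open D1.
  by apply: open_setI_preimage => // z [_ [Uz _]]; exact: phi_cont.
have oD2 : open D2.
  by apply: open_setI_preimage => // z [[_ [Uz _]] _]; exact: phi'_cont.
have [_ _ _ [Psi [Psis PsiPhi PhiPsi]]] := trU.
have [_ _ _ [Psi' [Psi's Psi'Phi' Phi'Psi']]] := trU'.
have domP z : chart_dom c z -> [/\ U (bundle_proj P (fibprod_fst z)),
    chart_dom a (bundle_proj P (fibprod_fst z)),
    chart_dom b (phi (fibprod_fst z)) & chart_dom b' (phi' (fibprod_snd z))].
  by rewrite domE => -[[[_ [? ?]] ?] ?].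
pose r (x0 : M) (y0 y0' : G) w := (Psi (chart_inv a x0 w.1, chart_inv b y0 w.2.1),
  Psi' (chart_inv a x0 w.1, chart_inv b' y0' w.2.2)) : P * P'.
have rc x0 y0 y0' z : chart_dom c z -> r x0 y0 y0' (c z) = set_val z.
  move=> /domP[Uz az bz b'z]; rewrite cE /r /= !chart_invK// PsiPhi//.
  rewrite fibprod_proj Psi'Phi' -?fibprod_proj//.
  by rewrite /fibprod_fst /fibprod_snd; case: (set_val z).
split.
- by rewrite domE.
- move=> z w; rewrite !inE => cz cw czw; apply: val_inj.
  by rewrite -[LHS](rc (bundle_proj P (fibprod_fst z)) 1%g 1%g)// czw rc.
- move=> z /domP[Uz az bz b'z].
  have -> : chart_fun c = (fun z => (a (bundle_proj P (fibprod_fst z)),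
    (b (phi (fibprod_fst z)), b' (phi' (fibprod_snd z))))) by exact/funext.
  apply: continuous_pair.
    apply: (@continuous_comp _ _ _ (bundle_proj P \o fibprod_fst) a) => //.
    by case: ac => _ _ + _; exact.
  apply: continuous_pair.
    apply: (@continuous_comp _ _ _ (phi \o fibprod_fst) b); first exact: phi_cont.
    by case: bc => _ _ + _; exact.
  apply: (@continuous_comp _ _ _ (phi' \o fibprod_snd) b'); first exact: phi'_cont.
  by case: b'c => _ _ + _; exact.
- move=> _ [W oW <-] sW.
  rewrite openE => _ [z0 Wz0 <-].
  pose B := (a @` (U `&` chart_dom a)) `*` ((b @` chart_dom b) `*` (b' @` chart_dom b')).
  have oB : open B.
    apply: open_setX; last apply: open_setX.
    + by apply: (chart_image_open ac); [exact: openI|exact: subIsetr].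
    + exact: chart_image_open.
    + exact: chart_image_open.
  pose r0 := r (bundle_proj P (fibprod_fst z0)) (phi (fibprod_fst z0))
    (phi' (fibprod_snd z0)).
  have r0_cont w : B w -> {for w, continuous r0}.
    case: w => _ [_ _] [/= [x [Ux ax] <-] [[y by_ <-] [y' b'y' <-]]].
    apply: continuous_pair.
      apply: (@continuous_comp _ _ _
        (fun w => (chart_inv a _ w.1, chart_inv b _ w.2.1)) Psi); last first.
        by apply: Psis.1; rewrite /= !chart_invK.
      apply: continuous_pair.
        apply: (@continuous_comp _ _ _ fst (chart_inv a _)); first exact: cvg_fst.
        exact: chart_inv_continuous.
      apply: (@continuous_comp _ _ _ (fst \o snd) (chart_inv b _)).
        by apply: continuous_comp; [exact: cvg_snd|exact: cvg_fst].
      exact: chart_inv_continuous.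
    apply: (@continuous_comp _ _ _
      (fun w => (chart_inv a _ w.1, chart_inv b' _ w.2.2)) Psi'); last first.
      by apply: Psi's.1; rewrite /= !chart_invK.
    apply: continuous_pair.
      apply: (@continuous_comp _ _ _ fst (chart_inv a _)); first exact: cvg_fst.
      exact: chart_inv_continuous.
    apply: (@continuous_comp _ _ _ (snd \o snd) (chart_inv b' _)).
      by apply: continuous_comp; [exact: cvg_snd|exact: cvg_snd].
    exact: chart_inv_continuous.
  have oBW : open (B `&` r0 @^-1` W) by exact: open_setI_preimage.
  have : nbhs (c z0) (B `&` r0 @^-1` W).
    apply: open_nbhs_nbhs; split=> //; have cz0 := sW _ Wz0.
    split; last by rewrite /preimage /mkset /r0 rc.
    have [Uz az bz b'z] := domP _ cz0.
    by rewrite cE; split=> /=; [|split=> /=]; eexists; eauto; split.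
  apply: filterS => -[_ [_ _]] [[/= [x [Ux ax] <-] [[y by_ <-] [y' b'y' <-]]]].
  rewrite /preimage /r0 /r /= !chart_invK// => Wxy.
  have Psixy := PhiPsi (x, y) Ux; have Psi'xy := Phi'Psi' (x, y') Ux.
  have xy : bundle_proj P (Psi (x, y)) = bundle_proj P' (Psi' (x, y')).
    by case: Psixy => -> _; case: Psi'xy => ->.
  exists (fibprod_mk xy); first by [].
  rewrite -[LHS]/(c (fibprod_mk xy)) cE /fibprod_fst /fibprod_snd /=.
  by case: Psixy => -> ->; case: Psi'xy => _ ->.
Qed.

Lemma fibprod_charted_space : charted_space fibprod.
Proof.
split; last exact: fibprod_atlas_cover.
move=> _ [U [phi [phi' [a [b [b' [trU trU' aM [bG b'G] ->]]]]]]].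
exact: fibprod_chart_is_chart.
Qed.

End Fibprod.

Arguments fibprod_fst {R n k M G P P'} z.
Arguments fibprod_snd {R n k M G P P'} z.

Lemma lie_group_charted_space (R : realType) (E : normedModType R)
    (G : lieGroupType E) : charted_space G.
Proof. exact: manifold_charted_space. Qed.

#[local] Hint Resolve lie_group_charted_space finite_dimensional_rV
  finite_dimensional_prod manifold_charted_space prod_charted_space fibprod_charted_space openT : core.

(** * The correspondence *)

Section Correspondence.
Context {R : realType} {n k : nat}.
Context {M : manifoldType 'rV[R]_n} {G : lieGroupType 'rV[R]_k}.
Variables P P' : principalBundle M G.
Local Notation fibprod := (fibprod P P').
Local Notation act := bundle_act.

Lemma fibprod_fst_smooth : smooth (fibprod_fst : fibprod -> P).
Proof.
split=> [z _|c d cA dP /= z0 _]; first exact: fibprod_fst_continuous.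
have cc := (fibprod_charted_space P P').1 c cA; rewrite setTI.
have lin : linear (fun w : 'rV[R]_n * ('rV[R]_k * 'rV[R]_k) => (w.1, w.2.1)).
  by [].
pose l : {linear ('rV[R]_n * ('rV[R]_k * 'rV[R]_k))%type ->
    ('rV[R]_n * 'rV[R]_k)%type} :=
  HB.pack (fun w : 'rV[R]_n * ('rV[R]_k * 'rV[R]_k) => (w.1, w.2.1))
    (GRing.isLinear.Build R _ _ _ _ lin).
have lc : continuous l.
  move=> w; apply: continuous_pair; first exact: cvg_fst.
  by apply: continuous_comp; [exact: cvg_snd|exact: cvg_fst].
move: cA cc => [U [phi [phi' [a [b [b' [trU trU' aM [bG b'G] ->]]]]]]] cc.
apply: (smooth_into_bundle (l := l) z0 cc trU aM bG _ lc) => //.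
  exact: fibprod_fst_continuous.
move=> z; have [-> ->] := fibprod_chartP U phi phi' a b b' z.
by move=> [].
Qed.

Lemma fibprod_snd_smooth : smooth (fibprod_snd : fibprod -> P').
Proof.
split=> [z _|c d cA dP /= z0 _]; first exact: fibprod_snd_continuous.
have cc := (fibprod_charted_space P P').1 c cA; rewrite setTI.
have lin : linear (fun w : 'rV[R]_n * ('rV[R]_k * 'rV[R]_k) => (w.1, w.2.2)).
  by [].
pose l : {linear ('rV[R]_n * ('rV[R]_k * 'rV[R]_k))%type ->
    ('rV[R]_n * 'rV[R]_k)%type} :=
  HB.pack (fun w : 'rV[R]_n * ('rV[R]_k * 'rV[R]_k) => (w.1, w.2.2))
    (GRing.isLinear.Build R _ _ _ _ lin).
have lc : continuous l.
  move=> w; apply: continuous_pair; first exact: cvg_fst.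
  by apply: continuous_comp; exact: cvg_snd.
move: cA cc => [U [phi [phi' [a [b [b' [trU trU' aM [bG b'G] ->]]]]]]] cc.
apply: (smooth_into_bundle (l := l) z0 cc trU' aM b'G _ lc) => //.
  exact: fibprod_snd_continuous.
move=> z; have [-> ->] := fibprod_chartP U phi phi' a b b' z.
by rewrite fibprod_proj => -[].
Qed.

(** The charts of the fibred product are built from the base point, which is
    that of the first component, and the two trivializations, each of which is
    smooth on [P] or [P'] over [U]. *)
Lemma smooth_on_fibprod (E : normedModType R) (X : chartedType E) (D : set X)
    (f : X -> fibprod) : charted_space X -> open D ->
  smooth_on D (fun x => fibprod_fst (f x)) ->
  smooth_on D (fun x => fibprod_snd (f x)) -> smooth_on D f.
Proof.
move=> Xc oD f1s f2s; have fc x : D x -> {for x, continuous f}.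
  move=> Dx; apply: continuous_set_val.
  rewrite (_ : (fun t => _) = (fun t => (fibprod_fst (f t), fibprod_snd (f t)))).
    by apply: continuous_pair; [exact: f1s.1|exact: f2s.1].
  by apply/funext => t; rewrite /fibprod_fst /fibprod_snd; case: (set_val (f t)).
split=> // c e cX eA /= x0 D'x0 j.
have oD' : open (D `&` chart_dom c `&` f @^-1` chart_dom e).
  apply: open_setI_preimage; first by apply: openI => //; have [] := Xc.1 c cX.
    by move=> x [Dx _]; exact: fc.
  by have [] := (fibprod_charted_space P P').1 e eA.
have ocD' := chart_image_open (Xc.1 c cX) oD' (fun x Dx => Dx.1.2).
case: eA oD' ocD' D'x0 =>
  [U [phi [phi' [a [b [b' [trU trU' aM [bG b'G] ->]]]]]]] oD' ocD' D'x0.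
have oU : open U by case: trU.
pose f1 x := fibprod_fst (f x); pose f2 x := fibprod_snd (f x).
have pis : smooth_on D (bundle_proj P \o f1).
  apply: (smooth_on_comp (D' := setT)) => //; exact: bundle_proj_smooth.
pose D1 := D `&` (bundle_proj P \o f1) @^-1` U.
have oD1 : open D1 by apply: open_setI_preimage => //; exact: pis.1.
have phis : smooth_on D1 (phi \o f1).
  apply: (smooth_on_comp _ _ _ _ _ _ _ _ (trivialization_smooth trU)) => //.
  - exact: open_bundle_proj_preimage.
  - by move=> x [].
  - by apply: smooth_on_sub f1s => x [].
have phi's : smooth_on D1 (phi' \o f2).
  apply: (smooth_on_comp _ _ _ _ _ _ _ _ (trivialization_smooth trU')) => //.
  - exact: open_bundle_proj_preimage.
  - by move=> x []; rewrite /preimage /= /f1 fibprod_proj.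
  - by apply: smooth_on_sub f2s => x [].
set d := fibprod_chart _ _ _ _ _ _ in oD' ocD' D'x0 *.
have domP x : (D `&` chart_dom c `&` f @^-1` chart_dom d) x ->
    [/\ D1 x, chart_dom c x, chart_dom a (bundle_proj P (f1 x)),
        chart_dom b (phi (f1 x)) & chart_dom b' (phi' (f2 x))].
  move=> [[Dx cx]]; rewrite /preimage /=.
  by have [_ /[apply] -[]] := fibprod_chartP U phi phi' a b b' (f x).
have [D1x0 cx0 ax0 bx0 b'x0] := domP _ D'x0.
have -> : d \o f \o chart_inv c x0 = (fun w =>
    ((a \o (bundle_proj P \o f1) \o chart_inv c x0) w,
     ((b \o (phi \o f1) \o chart_inv c x0) w,
      (b' \o (phi' \o f2) \o chart_inv c x0) w))).
  by apply/funext => w; have [dE _] := fibprod_chartP U phi phi' a b b'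
    (f (chart_inv c x0 w)); exact: dE.
apply: Ck_on_pair => //; last apply: Ck_on_pair => //.
- apply: Ck_on_sub (pis.2 c a cX aM x0 _ j) => //; last by split=> //; case: D1x0.
  by move=> _ [x /domP[[Dx _] cx ax _ _] <-]; exists x.
- apply: Ck_on_sub (phis.2 c b cX bG x0 _ j) => //.
  by move=> _ [x /domP[Dx cx _ bx _] <-]; exists x.
- apply: Ck_on_sub (phi's.2 c b' cX b'G x0 _ j) => //.
  by move=> _ [x /domP[Dx cx _ _ b'x] <-]; exists x.
Qed.

(** The element [g] of [G] exists and is unique for a bundle morphism [sigma], as
    [G] acts simply transitively on fibres; [1] is a default value for
    other maps. *)
Definition transition (sigma : P -> P') (z : fibprod) : G :=
  xget 1%g [set g | sigma (fibprod_fst z) = act (fibprod_snd z) g].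

Lemma transitionP sigma z : bundle_morphisms P P' sigma ->
  sigma (fibprod_fst z) = act (fibprod_snd z) (transition sigma z).
Proof.
move=> [_ sproj _]; have [|g sg] := @bundle_act_transitive _ _ _ _ _ P'
  (fibprod_snd z) (sigma (fibprod_fst z)); first by rewrite sproj fibprod_proj.
exact: (@xgetPex _ 1%g [set g | _ = act _ g] (ex_intro _ g sg)).
Qed.

(** In a trivialization [phi] of [P'], the relation [sigma p = p' g] becomes
    [phi (sigma p) = phi p' * g]. *)
Lemma transition_smooth sigma : bundle_morphisms P P' sigma ->
  smooth (transition sigma).
Proof.
move=> sM; have [ss sproj sact] := sM.
have FPc := fibprod_charted_space P P'.
have Gc : charted_space G := manifold_charted_space G.
have GGc := prod_charted_space Gc Gc.
have fdG := @finite_dimensional_rV R k.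
have fdGG := finite_dimensional_prod fdG fdG.
apply: smooth_on_local => // z _.
have [U [phi [Uz tr]]] := locally_trivial P' (bundle_proj P' (fibprod_snd z)).
have [oU _ phiG _] := tr; have phis := trivialization_smooth tr.
pose N := (bundle_proj P' \o (fibprod_snd : fibprod -> P')) @^-1` U.
have oN : open N.
  apply: open_comp => // y _; apply: continuous_comp.
    exact: fibprod_snd_continuous.
  exact: bundle_proj_continuous.
exists N, (fun y => ((phi (fibprod_snd y))^-1 * phi (sigma (fibprod_fst y)))%g).
split=> //.
  move=> y Ny; rewrite (transitionP y sM) phiG//.
  by rewrite mulKg.
have oPU := @open_bundle_proj_preimage _ _ _ _ _ P' U oU.
apply: (@smooth_on_comp _ _ _ _ _ _ _ N setT
  (fun y => ((phi (fibprod_snd y))^-1%g, phi (sigma (fibprod_fst y))))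
  (fun z => (z.1 * z.2)%g)) => //; last exact: mulg_smooth.
apply: (@smooth_on_pair _ _ _ _ _ _ _ N (fun y => (phi (fibprod_snd y))^-1%g)
  (fun y => phi (sigma (fibprod_fst y)))) => //.
  apply: (@smooth_on_comp _ _ _ _ _ _ _ N setT
    (fun y => phi (fibprod_snd y)) (fun g => g^-1%g)) => //; last exact: invg_smooth.
  apply: (@smooth_on_comp _ _ _ _ _ _ _ N _
    fibprod_snd phi _ _ _ _ _ oPU) => //.
  by apply: smooth_on_sub fibprod_snd_smooth.
apply: (@smooth_on_comp _ _ _ _ _ _ _ N _
  (fun y => sigma (fibprod_fst y)) phi _ _ _ _ _ oPU) => //.
  by move=> y Ny; rewrite /preimage /= sproj fibprod_proj.
apply: (@smooth_on_comp _ _ _ _ _ _ _ N setT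
  fibprod_fst sigma) => //.
by apply: smooth_on_sub fibprod_fst_smooth.
Qed.

Lemma fibprod_actE (z : fibprod) (g h : G) :
  fibprod_fst (fibprod_act z (g, h)) = act (fibprod_fst z) g /\
  fibprod_snd (fibprod_act z (g, h)) = act (fibprod_snd z) h :> P'.
Proof. by []. Qed.

Lemma transition_equivariant sigma : bundle_morphisms P P' sigma ->
  equivariant_maps P P' (transition sigma).
Proof.
move=> sM; have [ss sproj sact] := sM.
split=> [|z g h]; first exact: transition_smooth.
apply: (@bundle_act_inj _ _ _ _ _ P' (fibprod_snd (fibprod_act z (g, h)))).
rewrite -transitionP//; have [-> ->] := fibprod_actE z g h.
by rewrite sact (transitionP z sM) !bundle_actM !mulgA mulgV mul1g.
Qed.

Lemma transition_inj : {in bundle_morphisms P P' &, injective transition}.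
Proof.
move=> s t; rewrite !inE => sM tM st; apply/funext => p.
have [_ sproj _] := sM.
pose z := fibprod_mk (esym (sproj p)).
by rewrite -[p]/(fibprod_fst z) !transitionP// st.
Qed.

Lemma fibre_nonempty (x : M) : exists q : P', bundle_proj P' q = x.
Proof.
have [U [phi [Ux [_ _ _ [Psi [_ _ PhiPsi]]]]]] := locally_trivial P' x.
by exists (Psi (x, 1%g)); have [] := PhiPsi (x, 1%g) Ux.
Qed.

(** Invariance of [p' (K (p, p'))] under [p' |-> p' h], by which the choice of [p']
    in its fibre does not matter. *)
Lemma equivariant_eq K (p : P) (q q' : P') (pq : bundle_proj P p = bundle_proj P' q)
  (pq' : bundle_proj P p = bundle_proj P' q') : equivariant_maps P P' K ->
  act q (K (fibprod_mk pq)) = act q' (K (fibprod_mk pq')).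
Proof.
move=> [_ Ke].
have [|h q'E] := @bundle_act_transitive _ _ _ _ _ P' q q'.
  by rewrite -pq -pq'.
have -> : fibprod_mk pq' = fibprod_act (fibprod_mk pq) (1%g, h).
  apply: fibprod_eq; last exact: q'E.
  by rewrite -[RHS]/(act p 1%g) bundle_act1.
by rewrite Ke q'E bundle_actM !mulgA mulgV mul1g mulg1.
Qed.

(** [sigma] is defined with an arbitrary point [q p] of the fibre; its smoothness
    is then proved with the points of a smooth local section [s] instead. *)
Lemma transition_surj K : equivariant_maps P P' K ->
  exists2 sigma, bundle_morphisms P P' sigma & transition sigma = K.
Proof.
move=> KM; have [Ks Ke] := KM.
have [q qE] := choice (fun p => fibre_nonempty (bundle_proj P p)).
pose sigma p := act (q p) (K (fibprod_mk (esym (qE p)))).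
have sigmaE z : sigma (fibprod_fst z) = act (fibprod_snd z) (K z).
  rewrite /sigma (equivariant_eq _ (fibprod_proj z) KM).
  by congr (act _ (K _)); exact: fibprod_eq.
have sM : bundle_morphisms P P' sigma; last first.
  exists sigma => //; apply/funext => z.
  by apply: (@bundle_act_inj _ _ _ _ _ P' (fibprod_snd z)); rewrite -transitionP.
split=> [|p|p g]; last 2 first.
- by rewrite bundle_proj_act.
- pose z := fibprod_mk (esym (qE p)).
  have [zf zs] := fibprod_actE z g 1%g.
  rewrite -[p]/(fibprod_fst z) -zf !sigmaE zs bundle_act1 Ke invg1 mul1g.
  by rewrite bundle_actM.
have FPc := fibprod_charted_space P P'.
have Mc := manifold_charted_space M; have Gc := manifold_charted_space G.
have Pc := manifold_charted_space P; have P'c := manifold_charted_space P'.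
have MGc := prod_charted_space Mc Gc; have P'Gc := prod_charted_space P'c Gc.
have fdM := @finite_dimensional_rV R n; have fdG := @finite_dimensional_rV R k.
have fdP' := @finite_dimensional_rV R (total_dim P').
have fdMG := finite_dimensional_prod fdM fdG.
have fdP'G := finite_dimensional_prod fdP' fdG.
have fdFP := finite_dimensional_prod fdM (finite_dimensional_prod fdG fdG).
apply: smooth_on_local => // p _.
have [U [phi [Up [oU _ _ [Psi [Psis PsiPhi PhiPsi]]]]]] :=
  locally_trivial P' (bundle_proj P p).
pose N := bundle_proj P @^-1` U.
have oN : open N by exact: open_bundle_proj_preimage.
(* Outside of [N], [s] takes the values of [q], so that it lifts to a map
   into the fibred product defined everywhere. *)
pose s p := if `[< N p >] then Psi (bundle_proj P p, 1%g) else q p.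
have sE p' : bundle_proj P p' = bundle_proj P' (s p').
  rewrite /s; case: asboolP => [Np'|_]; last by rewrite qE.
  by have [-> _] := PhiPsi (bundle_proj P p', 1%g) Np'.
have ss : smooth_on N s.
  apply: smooth_on_local => // p' Np'.
  exists N, (Psi \o (fun p => (bundle_proj P p, 1%g))); split=> //.
    by move=> p2 Np2; rewrite /s asboolT.
  apply: (@smooth_on_comp _ _ _ _ _ _ _ N (U `*` setT)) => //.
  - by apply: open_setX => //; exact: openT.
  - apply: (@smooth_on_pair _ _ _ _ _ _ _ N (bundle_proj P) (fun=> 1%g)) => //.
      by apply: smooth_on_sub (bundle_proj_smooth P).
    exact: smooth_on_cst.
exists N, (fun p' => act (s p') (K (fibprod_mk (sE p')))); split=> //.
  by move=> p' _; exact: equivariant_eq.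
apply: (@smooth_on_comp _ _ _ _ _ _ _ N setT
  (fun p' => (s p', K (fibprod_mk (sE p')))) (fun z => act z.1 z.2)) => //.
- apply: (@smooth_on_pair _ _ _ _ _ _ _ N s
    (fun p' => K (fibprod_mk (sE p')))) => //.
  apply: (@smooth_on_comp _ _ _ _ _ _ _ N setT
    (fun p' => fibprod_mk (sE p')) K) => //.
  by apply: smooth_on_fibprod => //; exact: smooth_on_id.
- exact: bundle_act_smooth.
Qed.

End Correspondence.

Theorem theorem4p10 (R : realType) (n k : nat)
    (M : manifoldType 'rV[R]_n) (G : lieGroupType 'rV[R]_k)
    (P P' : principalBundle M G) (M_connected : connected [set: M]) :
  exists Theta : (P -> P') -> (fibprod P P' -> G),
    set_bij (bundle_morphisms P P') (equivariant_maps P P') Theta.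
Proof.
exists (@transition _ _ _ _ _ P P'); split.
- by move=> sigma; exact: transition_equivariant.
- exact: transition_inj.
- by move=> K /transition_surj[sigma sM <-]; exists sigma.
Qed.
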